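(* Let $n$ be an even positive integer and let $G=\mathrm{Cay}(\mathbb{Z}_n,S)$ be a circulant graph of order $n$ whose generating set $S$ satisfies the following properties: (i) $S$ does not contain the involution $\frac n2$; (ii) $S$ has a subset $M$ such that $|M|=\frac n2-2$ and $m_i+m_j\ne\frac n2$ for all $m_i,m_j\in M$; (iii) the complement $S\setminus M$ generates the whole group $\mathbb{Z}_n$. Then $\chi''(G)\le\Delta(G)+3$.
   Context: All graphs are finite, simple and undirected. For a group $H$ and a symmetric generating set $S\subset H$ (that is, $s\in S$ implies $s^{-1}\in S$) not containing the identity, the Cayley graph $\mathrm{Cay}(H,S)$ has vertex set $H$ and edges joining $g$ and $gs$ for $g\in H$, $s\in S$. A circulant graph is a Cayley graph on the cyclic group $H=\mathbb{Z}_n$, whose elements are written $0,1,\ldots,n-1$; sums of elements of $S$ are taken in $\mathbb{Z}_n$. A total coloring of $G$ is a coloring of its vertices and edges such that no two adjacent vertices, no two adjacent edges, and no edge and a vertex incident with it receive the same color; $\chi''(G)$ is the minimum number of colors in a total coloring, and $\Delta(G)$ is the maximum degree. *)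

(* Defs.v *)
From mathcomp Require Import all_boot all_order all_algebra all_fingroup.

Set Implicit Arguments.
Unset Strict Implicit.
Unset Printing Implicit Defensive.

Record sgraph := SGraph {
  vertex :> finType;
  adj : rel vertex;
  adj_sym : symmetric adj;
  adj_irrefl : irreflexive adj
}.

Section TotalColoring.
Variable G : sgraph.

Definition edges : {set {set G}} :=
  [set e : {set G} | [exists x, exists y, adj x y && (e == [set x; y])]].

Definition edge_type := {e : {set G} | e \in edges}.

Definition max_degree : nat := \max_(x : G) #|[set y | adj x y]|.

Definition element := (G + edge_type)%type.

(* An edge is its 2-set of endpoints, so distinct edges are adjacent exactly when
   these sets meet. *)
Definition conflict (a b : element) : bool :=
  match a, b with
  | inl x, inl y => adj x y
  | inl x, inr e => x \in val e
  | inr e, inl x => x \in val e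
  | inr e, inr f => (e != f) && (val e :&: val f != set0)
  end.

Definition total_coloring (k : nat) (c : {ffun element -> 'I_k}) : bool :=
  [forall a, forall b, conflict a b ==> (c a != c b)].

Definition total_colorable (k : nat) : bool :=
  [exists c : {ffun element -> 'I_k}, total_coloring c].

Lemma total_colorable_ex : exists k, total_colorable k.
Proof.
exists #|{: element}|; apply/existsP; exists [ffun a => enum_rank a].
apply/forallP=> a; apply/forallP=> b; apply/implyP; rewrite !ffunE.
apply: contraTneq => /enum_rank_inj <-.
by case: a => [x|e] /=; rewrite ?adj_irrefl ?eqxx.
Qed.

Definition total_chromatic_number : nat := ex_minn total_colorable_ex.

End TotalColoring.

Section Cayley.
Variable gT : finGroupType.
Implicit Type S : {set gT}.
Local Open Scope group_scope.

Definition connection_set S : Prop :=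
  [/\ <<S>> = [set: gT], {in S, forall s, s^-1 \in S} & 1 \notin S].

Definition cayley_adj S : rel gT :=
  fun g h => [exists s in S, h == g * s].

Lemma cayley_adj_sym S : connection_set S -> symmetric (cayley_adj S).
Proof.
case=> _ symS _; suff adjC g h : cayley_adj S g h -> cayley_adj S h g.
  by move=> g h; apply/idP/idP; apply: adjC.
case/exists_inP=> s sS /eqP->; apply/exists_inP.
by exists s^-1; rewrite ?symS ?mulgK.
Qed.

Lemma cayley_adj_irrefl S : connection_set S -> irreflexive (cayley_adj S).
Proof.
case=> _ _ S1 g; apply/exists_inP=> -[s sS].
by rewrite eq_mulVg1 mulKg => /eqP s1; rewrite -s1 sS in S1.
Qed.

Definition Cay S (hS : connection_set S) : sgraph :=
  SGraph (cayley_adj_sym hS) (cayley_adj_irrefl hS).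

End Cayley.

(* Main.v *)
Require Import Defs.
From mathcomp Require Import all_boot all_order all_algebra all_fingroup.
From mathcomp Require Import zify.

(* Put h = n/2. As S misses h, the vertices i and i + h are never adjacent, so a
   total coloring of the complete graph on Z_h (edge {i, j} gets i + j and vertex
   i gets 2i, modulo an odd L >= h) pulls back to a coloring of all the vertices
   of G and of any subgraph H in which no vertex has two neighbours congruent
   modulo h. Retaining as many edges as possible gives H the degree #|S mod h|.
   The sets M and h - M are disjoint by the condition on sums and both lie in
   S + {0, h}, so that degree is at least #|M| = h - 2, and at least h - 1 if h is
   even and h/2 is in S, as +-h/2 lies in neither set. In the latter case take
   L = h + 1; otherwise L = h works, even when h is even, because vertices
   congruent modulo h/2 are then not adjacent. Vizing's theorem colors the edges
   outside H with #|S| - deg H + 1 <= #|S| + 3 - L further colors. *)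

Set Implicit Arguments.
Unset Strict Implicit.
Unset Printing Implicit Defensive.

(** * Partial edge colorings and Kempe chains *)

Section EdgeColoring.
Variables T C : finType.
Implicit Types (c : T -> T -> option C) (a b d : C) (x y z u v w : T).

(** [None] marks a pair without a color, so the colored pairs themselves form the graph and no
    adjacency relation is carried along. *)
Definition edge_coloring c :=
  [/\ forall x, c x x = None,
      forall x y, c x y = c y x
    & forall x y z a, c x y = Some a -> c x z = Some a -> y = z].

Definition missing c x a := [forall y, c x y != Some a].

Lemma missingP c x a : reflect (forall y, c x y <> Some a) (missing c x a).
Proof. by apply: (iffP forallP) => h y; apply/eqP. Qed.

Definition kempe c a b : rel T :=
  fun x y => (c x y == Some a) || (c x y == Some b).

Lemma kempe_sym c a b : edge_coloring c -> symmetric (kempe c a b).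
Proof. by case=> _ cC _ x y; rewrite /kempe cC. Qed.

Lemma kempe_deg2 c a b u v w z : edge_coloring c ->
  kempe c a b u v -> kempe c a b u w -> kempe c a b u z -> v != w ->
  (z == v) || (z == w).
Proof.
case=> _ _ cP /orP[]/eqP uv /orP[]/eqP uw /orP[]/eqP uz;
  rewrite ?(cP _ _ _ _ uv uw) ?eqxx // ?(cP _ _ _ _ uz uv)
          ?(cP _ _ _ _ uz uw) ?eqxx ?orbT //.
Qed.

Definition kempe_end c a b u := missing c u a || missing c u b.

Lemma kempe_end_deg1 c a b u v w : edge_coloring c -> kempe_end c a b u ->
  kempe c a b u v -> kempe c a b u w -> v = w.
Proof.
case=> _ _ cP /orP[]/missingP mu /orP[]/eqP uv /orP[]/eqP uw;
  try (by case: (mu _ uv)); try (by case: (mu _ uw)); exact: cP uv uw.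
Qed.

(* The simple path joining two ends of a chain absorbs all the neighbours of its
   vertices, so it is the whole chain and has no third end. *)
Lemma kempe_three_ends c a b x y z : edge_coloring c ->
  kempe_end c a b x -> kempe_end c a b y -> kempe_end c a b z ->
  x != y -> z != x -> z != y ->
  connect (kempe c a b) x y -> ~~ connect (kempe c a b) x z.
Proof.
move=> cc ex ey ez neq_xy neq_zx neq_zy /connectP[p0 p0P defy].
move: p0P defy; case/shortenP=> p pP p_uniq _ defy.
have kC := kempe_sym a b cc.
(* The witnesses are the predecessor and, unless [u] is [y], the successor of [u] along the path. *)
have neighbours u : u \in p ->
    exists v1, [/\ kempe c a b u v1, v1 \in x :: p
      & u != y -> exists v2, [/\ v1 != v2, kempe c a b u v2 & v2 \in x :: p]].
  move=> up; case/splitPr: up pP p_uniq defy => p1 p2.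
  rewrite cat_path => /and3P[_ pu p2P] p_uniq defy.
  exists (last x p1); rewrite kC; split=> //.
    by rewrite -cat_cons mem_cat mem_last.
  case: p2 p2P p_uniq defy => [|v p2] /=.
    by rewrite last_cat => _ _ /= ->; rewrite eqxx.
  case/andP=> uv _; rewrite -/(uniq (x :: p1 ++ _)) -cat_cons cat_uniq.
  case/and3P=> _ /hasPn disj _ _ _; exists v; split=> //.
    apply: contraNneq (disj v _) => [<-|]; first exact: mem_last.
    by rewrite !inE eqxx orbT.
  by rewrite mem_cat !inE eqxx !orbT.
have clp : closed (kempe c a b) (mem (x :: p)).
  apply: intro_closed => [|u w uw]; first exact: sym_connect_sym.
  have [eq_ux _|neq_ux] := eqVneq u x.
    move: uw; rewrite eq_ux; case: (p) pP defy => [_ /= yx|v p' /= /andP[xv _] _ uw].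
      by rewrite yx eqxx in neq_xy.
    by rewrite (kempe_end_deg1 cc ex uw xv); apply/or3P; constructor 2.
  rewrite inE (negPf neq_ux) => /neighbours[v1 [uv1 pv1]].
  have [eq_uy _|_ /(_ isT)[v2 [neq_v uv2 pv2]]] := eqVneq u y.
    by rewrite -eq_uy in ey; rewrite (kempe_end_deg1 cc ey uw uv1).
  by case/orP: (kempe_deg2 cc uv1 uv2 uw neq_v) => /eqP->.
apply/negP=> /(closed_connect clp); rewrite !inE eqxx (negPf neq_zx) /= => /esym zp.
have [v1 [zv1 _ /(_ neq_zy)[v2 [neq_v zv2 _]]]] := neighbours _ zp.
by rewrite (kempe_end_deg1 cc ez zv1 zv2) eqxx in neq_v.
Qed.

Definition kempe_swap c a b z x y :=
  if connect (kempe c a b) z x then omap (tperm a b) (c x y) else c x y.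

Lemma kempe_swap_eq_None c a b z x y :
  (kempe_swap c a b z x y == None) = (c x y == None).
Proof. by rewrite /kempe_swap; case: ifP => // _; case: (c x y). Qed.

(** Testing only the first endpoint still gives a symmetric function: an edge colored [a] or [b] has
    both endpoints in one chain, and the transposition fixes every other color. *)
Lemma kempe_swap_coloring c a b z :
  edge_coloring c -> edge_coloring (kempe_swap c a b z).
Proof.
move=> cc; have kC := kempe_sym a b cc; have [c0 cC cP] := cc.
have kempeN x y : ~~ kempe c a b x y -> omap (tperm a b) (c x y) = c x y.
  rewrite negb_or; case: (c x y) => //= d /andP[da db].
  by rewrite tpermD // eq_sym.
split=> [x|x y|x y y' d]; rewrite /kempe_swap.
- by rewrite c0; case: ifP.
- rewrite [c y x]cC; have [xy|xy] := boolP (kempe c a b x y).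
    by rewrite (same_connect_r (sym_connect_sym kC) (connect1 xy)).
  by rewrite kempeN //; case: ifP; case: ifP.
case: ifP => _; last exact: cP.
case xy: (c x y) => [e|] //= -[<-]; case xy': (c x y') => [e'|] //= -[].
by move/perm_inj=> ee'; apply: cP xy _; rewrite -ee'.
Qed.

Lemma missing_swap_out c a b z x d : ~~ connect (kempe c a b) z x ->
  missing (kempe_swap c a b z) x d = missing c x d.
Proof. by move=> /negPf zx; rewrite /missing /kempe_swap zx. Qed.

Lemma missing_swap_in c a b z x d : connect (kempe c a b) z x ->
  missing (kempe_swap c a b z) x d = missing c x (tperm a b d).
Proof.
move=> zx; rewrite /missing /kempe_swap zx; apply: eq_forallb => y.
case: (c x y) => //= e; rewrite /eq_op /=.
by rewrite -(inj_eq (@perm_inj _ (tperm a b))) tpermK.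
Qed.

(** * Vizing fans *)

Definition joins x y u v := (u == x) && (v == y) || (u == y) && (v == x).

Lemma joinsC x y u v : joins x y u v = joins x y v u.
Proof. by rewrite /joins orbC ![(u == _) && _]andbC. Qed.

(** As [o] is an option, the same operation colors an edge and erases its color. *)
Definition recolor c x y o u v := if joins x y u v then o else c u v.

Lemma recolor_coloring c x y o : x != y ->
  (forall d, o = Some d -> missing c x d && missing c y d) ->
  edge_coloring c -> edge_coloring (recolor c x y o).
Proof.
move=> neq_xy oP [c0 cC cP]; split=> [u|u v|u v w d]; rewrite /recolor.
- rewrite c0 /joins; case: (eqVneq u x) => [->|] /=; last by rewrite andbF.
  by rewrite (negPf neq_xy).
- by rewrite joinsC cC.
case: ifP => uv; case: ifP => uw; last exact: cP; rewrite /joins in uv uw.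
- move=> _ _; case/orP: uv uw => /andP[/eqP-> /eqP->]; rewrite eqxx ?(negPf neq_xy).
    by rewrite orbF => /eqP.
  by rewrite eq_sym (negPf neq_xy) /= => /eqP.
- move/oP=> /andP[/missingP mx /missingP my]; move: uv.
  by case/orP=> /andP[/eqP-> _] => [/mx|/my].
move=> + /oP /andP[/missingP mx /missingP my]; move: uw.
by case/orP=> /andP[/eqP-> _] => [/mx|/my].
Qed.

(** Vizing's fans at [x] are the simple paths of this relation: at each step the edge from [x] to
    [y] could take over the color of the edge from [x] to [z]. *)
Definition fan c x : rel T :=
  fun y z => if c x z is Some d then missing c y d else false.

Lemma fanP c x y z :
  reflect (exists2 d, c x z = Some d & missing c y d) (fan c x y z).
Proof.
rewrite /fan; case xz: (c x z) => [d|]; last by constructor=> -[].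
apply: (iffP idP) => [|[e [->]]] //; by exists d.
Qed.

(** The color of the edge to [y1] moves to the edge to [y], which leaves a shorter fan starting at
    the now uncolored edge to [y1]. At the last vertex [a] is missing at both ends and finishes the
    coloring. *)
Lemma rotate_fan c x y p a : edge_coloring c -> x != y -> c x y = None ->
  path (fan c x) y p -> uniq (y :: p) ->
  missing c x a -> missing c (last y p) a ->
  exists2 c', edge_coloring c' &
    forall u v, (c' u v == None) = (c u v == None) && ~~ joins x y u v.
Proof.
elim: p c y => [|y1 p IHp] c y cc neq_xy xy /=.
  move=> _ _ mx my; exists (recolor c x y (Some a)).
    by apply: recolor_coloring => // d [<-]; rewrite mx.
  by move=> u v; rewrite /recolor; case: ifP; rewrite ?andbF ?andbT.
case/andP=> /fanP[b xy1 myb] fanp /andP[yp p_uniq] mx ml.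
have [c0 cC cP] := cc.
have neq_xy1 : x != y1 by apply: contra_eq_neq xy1 => <-; rewrite c0.
have neq_yy1 : y != y1 by apply: contra_eq_neq xy1 => <-; rewrite xy.
pose c1 := recolor (recolor c x y1 None) x y (Some b).
have cc1 : edge_coloring c1.
  apply: recolor_coloring => // [d [<-]|]; last exact: recolor_coloring.
  apply/andP; split; apply/missingP=> v; rewrite /recolor /joins.
    rewrite eqxx; case: (eqVneq v y1) => //= neq_v.
    case: ifP => // _ xv; case/eqP: neq_v; exact: cP xv xy1.
  by case: ifP => // _; apply/missingP.
have c1x z : z != y -> z != y1 -> c1 x z = c x z.
  move=> zy zy1; rewrite /c1 /recolor /joins (negPf zy) (negPf zy1).
  by rewrite (negPf neq_xy) (negPf neq_xy1) !andbF.
(* Away from [x] and [y] the only possible change is an erased color, so no missing color is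
   lost. *)
have mc1 u d : u != x -> u != y -> missing c u d -> missing c1 u d.
  move=> ux uy /missingP mu; apply/missingP=> v.
  rewrite /c1 /recolor {1}/joins (negPf ux) (negPf uy) /=.
  by case: ifP => // _; apply: mu.
have pNx u : u \in y1 :: p -> u != x.
  rewrite inE => /predU1P[->|]; first by rewrite eq_sym.
  move=> up; case/splitPr: up fanp => p1 p2; rewrite cat_path => /= /and3P[_ + _].
  by case/fanP=> d + _; apply: contra_eq_neq => ->; rewrite c0.
have pNy u : u \in y1 :: p -> u != y by move=> up; apply: contraNneq yp => <-.
have fan1 : path (fan c1 x) y1 p.
  apply/(pathP y1)=> i ip; have pi := mem_nth y1 ip.
  have pi' : nth y1 (y1 :: p) i \in y1 :: p by rewrite mem_nth // ltnW.
  have /fanP[d xz mz] := (pathP y1 fanp) i ip.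
  apply/fanP; exists d; last by rewrite mc1 ?pNx ?pNy.
  rewrite c1x ?pNy ?inE ?pi ?orbT //.
  by case/andP: p_uniq => + _; apply: contraNneq => <-.
have [] := IHp c1 y1 cc1 neq_xy1 _ fan1 p_uniq.
- by rewrite /c1 /recolor /joins !eqxx (eq_sym y1) (negPf neq_yy1) (negPf neq_xy) andbF.
- apply/missingP=> v; rewrite /c1 /recolor; case: ifP => _.
    by case=> ba; move/missingP: mx => /(_ y1); rewrite -ba.
  by case: ifP => // _; apply/missingP.
- by apply: mc1 ml; rewrite ?pNx ?pNy // mem_last.
move=> c' cc' c'E; exists c' => // u v; rewrite {}c'E /c1 /recolor.
have [uv1|_] := boolP (joins x y1 u v); last first.
  by rewrite andbT; case: ifP; rewrite ?andbF ?andbT.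
have -> : c u v = Some b by case/orP: uv1 => /andP[/eqP-> /eqP->] //; rewrite cC.
by rewrite andbF.
Qed.

(* Swapping the chain through [y] could break the fan only at a vertex of that chain
   missing [b], and there the truncated fan already ends at a vertex missing [a]. *)
Lemma swap_fan c a b x y u : edge_coloring c -> missing c x a ->
  missing c y b -> ~~ connect (kempe c a b) y x -> connect (fan c x) u y ->
  let c1 := kempe_swap c a b y in
  exists2 w, connect (fan c1 x) u w & missing c1 w a.
Proof.
move=> cc mx my yx /connectP[p pP defy] c1.
elim: p u pP defy => [|v p IHp] u /=.
  move=> _ <-; exists y; first exact: connect0.
  by rewrite missing_swap_in ?connect0 // tpermL.
case/andP=> /fanP[d xv mu] vp defy.
have [/andP[yu mub]|uN] := boolP (connect (kempe c a b) y u && missing c u b).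
  by exists u; rewrite ?connect0 // missing_swap_in // tpermL.
have [w vw mw] := IHp v vp defy; exists w => //.
apply: connect_trans (connect1 _) vw; apply/fanP; exists d.
  by rewrite /c1 /kempe_swap (negPf yx).
have [yu|yu] := boolP (connect (kempe c a b) y u); last by rewrite missing_swap_out.
(* The swap fixes [d]: it is not [a], which is missing at [x], and not [b], by the choice of [u]. *)
rewrite missing_swap_in // tpermD //.
  by apply: contraTneq mx => ->; apply/missingP => /(_ v).
by apply: contraNneq uN => eq_bd; rewrite yu eq_bd.
Qed.

Lemma extend_fan c x y w a : edge_coloring c -> x != y -> c x y = None ->
  connect (fan c x) y w -> missing c x a -> missing c w a ->
  exists2 c', edge_coloring c' &
    forall u v, (c' u v == None) = (c u v == None) && ~~ joins x y u v.
Proof.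
move=> cc neq_xy xy /connectP[p0 p0P ->]; case/shortenP: p0P => p pP p_uniq _.
exact: rotate_fan.
Qed.

(** Let [R] be the vertices reachable from [y] by fans at [x]. If one of them shares a missing color
    with [x], rotation suffices. Otherwise, a color missing at [u] in [R] is used at [x] on an edge
    to some [f u] in [R] other than [y]. By counting, [f] is not injective on [R], so two vertices
    of [R] miss the same [b]. With [x], which misses [a], they would be three ends of one chain;
    hence one of them lies off the chain of [x], and swapping its chain makes [a] usable. *)
Lemma extend_edge_coloring c x y : edge_coloring c -> x != y -> c x y = None ->
  (forall u, exists a, missing c u a) ->
  exists2 c', edge_coloring c' &
    forall u v, (c' u v == None) = (c u v == None) && ~~ joins x y u v.
Proof.
move=> cc neq_xy xy free; have [a mx] := free x.
pose R := [set u | connect (fan c x) y u].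
have [/exists_inP[w wR /existsP[d /andP[mxd mwd]]]|noR] :=
    boolP [exists w in R, [exists d, missing c x d && missing c w d]].
  by rewrite inE in wR; apply: (extend_fan cc neq_xy xy wR mxd mwd).
(* The premise stands under the existential so that choice gives a function on all vertices. *)
have nxt u : exists z, u \in R ->
    z \in R :\ y /\ exists2 b, c x z = Some b & missing c u b.
  have [b mu] := free u.
  have [uR|] := boolP (u \in R); last by exists u.
  have: ~~ missing c x b.
    by apply: contra noR => mxb; apply/exists_inP; exists u => //;
       apply/existsP; exists b; rewrite mxb.
  rewrite negb_forall => /existsP[z /negPn/eqP xz]; exists z => _.
  split; last by exists b.
  rewrite !inE; apply/andP; split; first by apply: contra_eq_neq xz => ->; rewrite xy.
  rewrite inE in uR; apply: connect_trans uR (connect1 _); apply/fanP; by exists b.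
have [f fP] := fin_all_exists nxt.
have /dinjectivePn[u uR [u' /andP[/= neq_u uR'] eq_f]] : ~~ dinjectiveb f R.
  apply/negP => /dinjectiveP/card_in_imset card_f.
  have /subset_leq_card : f @: R \subset R :\ y.
    by apply/subsetP=> _ /imsetP[u uR ->]; case: (fP u uR).
  rewrite card_f (cardsD1 y R) inE connect0 ltnn //.
have [_ [b xz mu]] := fP u uR; have [_ [b' xz' mu']] := fP u' uR'.
have {xz'}eq_b : b = b' by move: xz'; rewrite -eq_f xz => -[].
subst b'; have kC := kempe_sym a b cc.
have x_nb : ~~ missing c x b by apply/missingP=> /(_ (f u)).
have neq_xu w : missing c w b -> w != x by apply: contraTneq => ->.
suff [w [wR mw xw]] : exists w, [/\ w \in R, missing c w b &
                          ~~ connect (kempe c a b) w x].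
  have cc1 := kempe_swap_coloring a b w cc; rewrite inE in wR.
  have [t yt mt] := swap_fan cc mx mw xw wR.
  have [||c' cc' c'E] := extend_fan cc1 neq_xy _ yt _ mt.
  - by apply/eqP; rewrite kempe_swap_eq_None xy.
  - by rewrite missing_swap_out.
  by exists c' => // u1 v1; rewrite c'E kempe_swap_eq_None.
have ends : ~~ (connect (kempe c a b) x u && connect (kempe c a b) x u').
  apply/negP=> /andP[xu]; apply/negP; apply: (kempe_three_ends cc _ _ _ _ _ _ xu).
  - by rewrite /kempe_end mx.
  - by rewrite /kempe_end mu orbT.
  - by rewrite /kempe_end mu' orbT.
  - by rewrite eq_sym neq_xu.
  - exact: neq_xu.
  - done.
have cs := sym_connect_sym kC.
case/nandP: ends => xu; [exists u | exists u']; split=> //; by rewrite cs.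
Qed.

End EdgeColoring.

(** * Vizing's theorem *)

(** Induction on the number of adjacent ordered pairs: one edge is removed, the rest is colored, and
    the coloring is extended to that edge. *)
Theorem vizing (T : finType) (e : rel T) k :
  symmetric e -> irreflexive e -> (forall x, #|[set y | e x y]| < k) ->
  exists2 c : T -> T -> option 'I_k, edge_coloring c &
    forall x y, (c x y == None) = ~~ e x y.
Proof.
elim: {e}_.+1 {-2}e (ltnSn #|[set p | e p.1 p.2]|) => // m IHm e lt_m eC e0 deg.
have [/existsP[[x y] /= exy]|noe] := boolP [exists p, e p.1 p.2]; last first.
  exists (fun _ _ => None); first by split.
  by move=> x y; apply/esym; apply: contra noe => exy; apply/existsP; exists (x, y).
have neq_xy : x != y by apply: contraTneq exy => ->; rewrite e0.
pose e' : rel T := fun u v => e u v && ~~ joins x y u v.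
have sub u : [set v | e' u v] \subset [set v | e u v].
  by apply/subsetP=> v; rewrite !inE => /andP[].
have [||||c cc cE] := IHm e'.
- rewrite ltnS in lt_m; apply: leq_trans lt_m; apply: proper_card; apply/properP; split.
    by apply/subsetP=> v; rewrite !inE => /andP[].
  by exists (x, y); rewrite !inE //= /e' /joins !eqxx andbF.
- by move=> u v; rewrite /e' eC joinsC.
- by move=> u; rewrite /e' e0.
- by move=> u; apply: leq_ltn_trans (deg u); apply: subset_leq_card.
have [|u|c' cc' c'E] := extend_edge_coloring cc neq_xy.
- by apply/eqP; rewrite cE /e' /joins !eqxx andbF.
(* At a vertex missing no color, the edges would carry all [k] colors, against the degree bound. *)
- apply/existsP; apply: contraLR (deg u); rewrite -leqNgt => /existsPn full.
  apply: leq_trans (subset_leq_card (sub u)).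
  have: [set: option 'I_k] :\ None \subset c u @: [set v | e' u v].
    apply/subsetP; case=> [d|]; rewrite !inE // => _; have := full d; rewrite negb_forall.
    case/existsP=> v /negPn/eqP uv; apply/imsetP; exists v => //.
    by rewrite inE -[e' u v]negbK -cE uv.
  move/subset_leq_card/leq_trans/(_ (leq_imset_card _ _)); apply: leq_trans.
  by rewrite -ltnS -[k in k < _]card_ord -card_option -cardsT (cardsD1 None) in_setT.
exists c' => // u v; rewrite c'E cE /e' negb_and negbK; case: (boolP (joins _ _ _ _)).
  by case/orP=> /andP[/eqP-> /eqP->]; rewrite ?exy 1?eC ?exy orbT.
by rewrite orbF andbT.
Qed.

(** * Total colorings from numerical color functions *)

Section TotalColoringBound.
Variables (G : sgraph) (k : nat) (f : G -> nat) (g : G -> G -> nat).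
Hypotheses (f_lt : forall x, f x < k) (g_lt : forall x y, adj x y -> g x y < k).
Hypothesis gC : forall x y, g x y = g y x.
Hypothesis f_proper : forall x y, adj x y -> f x != f y.
Hypothesis fg_proper : forall x y, adj x y -> f x != g x y.
Hypothesis g_proper :
  forall x y z, adj x y -> adj x z -> y != z -> g x y != g x z.

(** Edges are 2-subsets, while [g] takes ordered pairs; each edge gets an arbitrary ordering of its
    endpoints, which [gC] makes harmless. *)
Lemma total_chromatic_number_leq : total_chromatic_number G <= k.
Proof.
have ends (e : edge_type G) :
    exists uv : G * G, adj uv.1 uv.2 && (val e == [set uv.1; uv.2]).
  have := valP e; rewrite inE => /existsP[x /existsP[y exy]].
  by exists (x, y).
pose ge e := let uv := xchoose (ends e) in g uv.1 uv.2.
have geP (e : edge_type G) (x : G) : x \in val e ->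
    exists y, [/\ adj x y, val e = [set x; y] & ge e = g x y].
  have /andP[uv /eqP defe] := xchooseP (ends e).
  rewrite {1}defe !inE => /orP[]/eqP->.
    by exists (xchoose (ends e)).2.
  by exists (xchoose (ends e)).1; rewrite adj_sym setUC gC.
pose col (a : element G) := match a with inl x => f x | inr e => ge e end.
have col_lt a : col a < k.
  case: a => [x|e] //=.
  by have /andP[uv _] := xchooseP (ends e); apply: g_lt.
rewrite /total_chromatic_number; case: ex_minnP => m _; apply.
apply/existsP; exists [ffun a => Ordinal (col_lt a)].
apply/forallP=> a; apply/forallP=> b; apply/implyP; rewrite !ffunE -val_eqE /=.
case: a b => [x|e] [y|e'] /=; first exact: f_proper.
- by case/geP=> z [xz _ ->]; apply: fg_proper.
- by case/geP=> z [xz _ ->]; rewrite eq_sym; apply: fg_proper.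
case/andP=> neq_e /set0Pn[x /setIP[/geP[y [xy defe ->]] /geP[z [xz defe' ->]]]].
apply: g_proper => //; apply: contraNneq neq_e => eq_yz.
by apply/eqP/val_inj; rewrite defe defe' eq_yz.
Qed.

End TotalColoringBound.

(** * Congruences modulo n/2 and the retained subgraph *)

Section Circulant.
Import GRing.Theory.
Local Open Scope ring_scope.

Lemma val_Zp_sub n (x y : 'Z_n) : (1 < n)%N -> ((x - y)%R = (x + (n - y)) %% n :> nat)%N.
Proof. by case: n x y => [|[|n]] // x y _ /=; rewrite modnDmr. Qed.

Lemma val_Zp_add n (x y : 'Z_n) : (1 < n)%N -> ((x + y)%R = (x + y) %% n :> nat)%N.
Proof. by case: n x y => [|[|n]]. Qed.

Lemma ltn_Zp n (x : 'Z_n) : (1 < n)%N -> (x < n)%N.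
Proof. by case: n x => [|[|n]] // x _; apply: ltn_ord. Qed.

Lemma dvdn_Zp_sub n m (x y : 'Z_n) : (1 < n)%N -> (m %| n)%N ->
  (x = y %[mod m] -> m %| (x - y)%R)%N.
Proof.
move=> n1 mn eq_xy; have yn := ltnW (ltn_Zp y n1).
rewrite val_Zp_sub // /dvdn modn_dvdm // addnBA // -/(_ %| _)%N.
rewrite -eqn_mod_dvd ?(leq_trans yn) ?leq_addl // -modnDmr (eqP mn) addn0.
exact/eqP.
Qed.

Lemma Zp_multiple n q m (x : 'Z_n) : (1 < n)%N -> (q * m = n)%N -> (m %| x)%N ->
  exists2 i, (i < q)%N & x = (i * m)%:R.
Proof.
move=> n1 qm /dvdnP[i xi]; exists i; last by rewrite -xi natr_Zp.
by have := ltn_Zp x n1; rewrite xi -qm ltn_mul2r => /andP[].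
Qed.

Variables (n h : nat).
Hypotheses (nE : n = (2 * h)%N) (h_gt1 : (1 < h)%N).
Let n_gt1 : (1 < n)%N. Proof. lia. Qed.

Local Notation hh := (h%:R : 'Z_n).

Lemma natr_half_double : hh + hh = 0.
Proof. by rewrite -natrD addnn -mul2n -nE pchar_Zp. Qed.

Lemma natr_half_opp : - hh = hh.
Proof. by apply/eqP; rewrite eq_sym -addr_eq0 natr_half_double. Qed.

Lemma modn_half_eq (x y : 'Z_n) : (y = x %[mod h])%N -> y = x \/ y = x + hh.
Proof.
move=> eq_yx; have hn : (h %| n)%N by rewrite nE dvdn_mull.
have [[|[|i]] // _ d] := Zp_multiple n_gt1 (esym nE) (dvdn_Zp_sub n_gt1 hn eq_yx).
  by left; apply/eqP; rewrite -subr_eq0 d mul0n.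
by right; rewrite -[y](subrK x) d mul1n addrC.
Qed.

Lemma ltn_add_half (x : 'Z_n) : ((x + hh)%R < h)%N = ~~ (x < h)%N.
Proof.
rewrite val_Zp_add // val_Zp_nat // (@modn_small h); last by lia.
have xn := ltn_Zp x n_gt1; case: (ltnP x h) => xh.
  by rewrite modn_small; lia.
have -> : (x + h = (x - h) + n)%N by lia.
by rewrite modnDr modn_small; lia.
Qed.

Variable S : {set 'Z_n}.
Hypotheses (S0 : 0 \notin S) (Sh : h%:R \notin S).
Hypothesis SN : {in S, forall s, - s \in S}.

Lemma opp_mem s : (- s \in S) = (s \in S).
Proof. by apply/idP/idP => [/SN|/SN //]; rewrite opprK. Qed.

Lemma adj_modn_half (x y : 'Z_n) : y - x \in S -> (y <> x %[mod h])%N.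
Proof.
move=> yxS /modn_half_eq[] eq_y; move: yxS; rewrite eq_y.
  by rewrite subrr (negPf S0).
by rewrite addrAC subrr add0r (negPf Sh).
Qed.

(** Vertices congruent modulo [e] differ by 0, [e], [2 * e = h] or [3 * e = - e] in Z_n, and none of
    these lies in [S]. *)
Lemma adj_modn_quarter e (x y : 'Z_n) : h = (2 * e)%N -> e%:R \notin S ->
  y - x \in S -> (y <> x %[mod e])%N.
Proof.
move=> hE Se yxS eq_yx; have en : (e %| n)%N by rewrite nE hE mulnA dvdn_mull.
have e4 : (4 * e = n)%N by rewrite nE hE mulnA.
have [i i4 d] := Zp_multiple n_gt1 e4 (dvdn_Zp_sub n_gt1 en eq_yx).
move: yxS; rewrite {}d; case: i i4 => [|[|[|[|i]]]] // _.
- by rewrite mul0n (negPf S0).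
- by rewrite mul1n (negPf Se).
- by rewrite -hE (negPf Sh).
move/SN; have -> : - (3 * e)%:R = e%:R :> 'Z_n.
  by apply/eqP; rewrite eq_sym -addr_eq0 -natrD -mulSn e4 pchar_Zp.
by rewrite (negPf Se).
Qed.

(* Of the four edges joining {i, i + n/2} to {j, j + n/2}, when all are present,
   only the perfect matching within the two halves is retained. *)
Definition half_adj (i j : 'Z_n) : bool :=
  (j - i \in S) && ((j - i + hh \notin S) || ((i < h)%N == (j < h)%N)).

Lemma half_adj_sym : symmetric half_adj.
Proof.
move=> i j; rewrite /half_adj -opp_mem opprB eq_sym.
by rewrite -[j - i + hh \in S]opp_mem opprD opprB natr_half_opp.
Qed.

(** Distinct [j] and [j'] would differ by [h], so both differences from [i] lie in [S] and both
    edges are confined to the half of [i]; but adding [h] changes the half. *)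
Lemma half_adj_inj i j j' : half_adj i j -> half_adj i j' ->
  (j = j' %[mod h])%N -> j = j'.
Proof.
move=> /andP[jS jH] /andP[jS' jH'] /modn_half_eq[] // eq_j.
have eq_d : j - i = j' - i + hh by rewrite eq_j addrAC.
have eq_d' : j - i + hh = j' - i by rewrite eq_d -addrA natr_half_double addr0.
move: jH jH'; rewrite eq_d' -eq_d jS jS' /= => /eqP-> /eqP.
by rewrite eq_j ltn_add_half; case: (_ < _)%N.
Qed.

Definition half_cover := [set d : 'Z_n | (d \in S) || (d + hh \in S)].

(** For [d] in the cover, [i + d] or [i + d + hh] is a retained neighbour of [i], so two translates
    of the retained neighbourhood contain the cover. *)
Lemma card_half_adj i : (#|half_cover| <= 2 * #|[set j | half_adj i j]|)%N.
Proof.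
set N := [set j | _].
have /subset_leq_card : half_cover \subset
    [set j - i | j in N] :|: [set j - i + hh | j in N].
  apply/subsetP=> d; rewrite 2!inE => dW.
  suff [dN|dhN] : i + d \in N \/ i + d + hh \in N.
  - by apply/orP; left; apply/imsetP; exists (i + d); rewrite // addrC addKr.
  - apply/orP; right; apply/imsetP; exists (i + d + hh) => //.
    by rewrite addrAC -(addrA (i + d)) natr_half_double addr0 addrC addKr.
  have e1 : i + d - i = d by rewrite addrC addKr.
  have e2 : i + d + hh - i = d + hh by rewrite addrAC e1.
  rewrite !inE /half_adj e1 e2 -(addrA d) natr_half_double addr0 ltn_add_half.
  (* When both differences lie in [S], exactly one of the two vertices is in the half of [i]. *)
  by case: (d \in S) (d + hh \in S) dW (i < h)%N ((i + d)%R < h)%N => [] [] // _ [] []; auto.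
move/leq_trans; apply; apply: leq_trans (leq_card_setU _ _) _.
by rewrite mul2n -addnn leq_add // leq_imset_card.
Qed.

(** [M], its reflection [tM] and [A] are pairwise disjoint, since a common element would yield two
    elements of [M], possibly equal, with sum [h]. The reflection lies in the cover because
    [h - m + h = - m]. The set [A] is meant for the halves of [h] in [S]. *)
Lemma card_cover_transversal (M A : {set 'Z_n}) : M \subset S -> A \subset S ->
  (forall m m', m \in M -> m' \in M -> m + m' <> hh) ->
  (forall a, a \in A -> a + a = hh) ->
  (2 * #|M| + #|A| <= #|half_cover|)%N.
Proof.
move=> sMS sAS M_sum A_sum; pose tM := [set hh - m | m in M].
have card_tM : #|tM| = #|M|.
  by apply: card_imset => m m' /addrI/oppr_inj.
have disMt : [disjoint M & tM].
  apply/pred0P=> m /=; apply/negP=> /andP[mM /imsetP[m' mM' eq_m]].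
  by apply: (M_sum m m'); rewrite // eq_m subrK.
have disA : [disjoint A & M :|: tM].
  apply/pred0P=> a /=; apply/negP=> /andP[/A_sum aa]; rewrite inE => /orP[aM|].
    exact: (M_sum a a).
  case/imsetP=> m mM eq_a; apply: (M_sum m m) => //.
  have -> : m = hh - a by rewrite eq_a opprB addrC subrK.
  by rewrite addrACA -opprD aa natr_half_double sub0r natr_half_opp.
have card_u : #|A :|: (M :|: tM)| = (2 * #|M| + #|A|)%N.
  rewrite -[RHS]addnC mul2n -addnn -{2}card_tM.
  by rewrite !cardsU !disjoint_setI0 // cards0 !subn0.
rewrite -card_u; apply/subset_leq_card/subsetP=> d; rewrite !inE.
case/or3P=> [/(subsetP sAS)-> //|/(subsetP sMS)-> //|].
case/imsetP=> m /(subsetP sMS) mS ->.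
by rewrite addrAC natr_half_double sub0r opp_mem mS orbT.
Qed.

End Circulant.

(** * The total coloring of the circulant graph *)

Lemma double_eqmod_odd L a b : odd L -> a < L -> b < L ->
  2 * a = 2 * b %[mod L] -> a = b.
Proof.
move=> oddL; wlog le_ba : a b / b <= a => [hyp aL bL ab|aL bL /eqP].
  by case: (leqP b a) => [|/ltnW] le; [|apply/esym]; apply: hyp.
rewrite eqn_mod_dvd ?leq_mul2l // -mulnBr Gauss_dvdr ?coprimen2 //.
have [|ba] := posnP (a - b); first by lia.
by move/(dvdn_leq ba); lia.
Qed.

Section CirculantBound.
Import GRing.Theory.
Local Open Scope ring_scope.

Lemma cayley_adjE n (S : {set 'Z_n}) (x y : 'Z_n) : cayley_adj S x y = (y - x \in S).
Proof.
apply/exists_inP/idP => [[s sS /eqP->]|yxS]; last first.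
  by exists (y - x) => //; apply/eqP; rewrite [RHS]addrC subrK.
by have -> : (x * s)%g - x = s :> 'Z_n by rewrite [(x * s)%g]addrC addrK.
Qed.

Lemma card_translate n (S : {set 'Z_n}) (x : 'Z_n) : #|[set y | y - x \in S]| = #|S|.
Proof.
rewrite -(card_imset S (addrI x)); apply: eq_card => y; rewrite inE.
apply/idP/imsetP => [yxS|[s sS ->]]; last by rewrite addrC addKr.
by exists (y - x) => //; rewrite addrC subrK.
Qed.

Lemma circulant_total_chromatic n h (S M : {set 'Z_n}) (hS : connection_set S) :
  n = (2 * h)%N -> h%:R \notin S -> M \subset S -> (#|M| + 2 = h)%N ->
  (forall m m' : 'Z_n, m \in M -> m' \in M -> m + m' <> h%:R) ->
  (total_chromatic_number (Cay hS) <= #|S| + 3)%N.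
Proof.
move=> nE Sh sMS card_M M_sum.
have [_ SN' S0'] := hS.
have SN : {in S, forall s, - s \in S} by exact: SN'.
have S0 : 0 \notin S by exact: S0'.
have [h1|h_gt1] := leqP h 1; first by lia.
pose ee : 'Z_n := (h./2)%:R.
have eeE : ~~ odd h -> ee + ee = h%:R by move=> evh; rewrite -natrD; congr _%:R; lia.
have h_neq0 : h%:R != 0 :> 'Z_n.
  by rewrite -val_eqE /= val_Zp_nat ?modn_small; lia.
pose L := if ~~ odd h && (ee \in S) then h.+1 else h.
have hL : (h <= L)%N by rewrite /L; case: ifP.
have L_le i : (L <= #|[set j | half_adj h S i j]| + 2)%N.
  (* The two elements of [A] are distinct, as [ee = - ee] would force [h = 0] in Z_n; they add one
     to the degree bound and so pay for [L = h + 1]. *)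
  pose A := if ~~ odd h && (ee \in S) then [set ee; - ee] else set0.
  have LE : L = (h + (#|A| == 2))%N.
    rewrite /L /A; case: ifP => [/andP[evh _]|_]; last by rewrite cards0 addn0.
    by rewrite cards2 -addr_eq0 eeE // h_neq0 addn1.
  have sAS : A \subset S.
    rewrite /A; case: ifP => [/andP[_ eeS]|_]; last exact: sub0set.
    by apply/subsetP=> a; rewrite !inE => /orP[]/eqP->; rewrite // SN.
  have A_sum a : a \in A -> a + a = h%:R.
    rewrite /A; case: ifP => [/andP[evh _]|_]; rewrite !inE // => /orP[]/eqP->.
      exact: eeE.
    by rewrite -opprD eeE // (natr_half_opp nE h_gt1).
  have := leq_trans (card_cover_transversal nE h_gt1 SN sMS sAS M_sum A_sum)
                    (card_half_adj nE h_gt1 S i).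
  rewrite LE -card_M => le_MN; move: le_MN.
  by case: eqP => /= [->|_]; clear; move: #|M| #|[set j | _]| => p q; lia.
have vertexP (x y : 'Z_n) : y - x \in S -> (2 * (x %% h) <> 2 * (y %% h) %[mod L])%N.
  move=> yxS; have neq := adj_modn_half nE h_gt1 S0 Sh yxS.
  have [xh yh] : (x %% h < h)%N /\ (y %% h < h)%N by rewrite !ltn_mod; lia.
  rewrite /L; case: ifP => [/andP[evh _]|].
    by move/double_eqmod_odd => eq; apply: neq; rewrite eq //; lia.
  have [oddh _|evh /negbT Se] := boolP (odd h).
    by move/double_eqmod_odd => eq; apply: neq; rewrite eq.
  (* Here [L = h] is even, and doubling modulo [h] remembers only the residue modulo [h/2]. *)
  have hE : h = (2 * h./2)%N by lia.
  move=> eq_xy; apply: (adj_modn_quarter nE h_gt1 S0 Sh SN hE Se yxS).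
  have mod_half z : (2 * (z %% h) %% h = 2 * (z %% h./2))%N.
    by rewrite modnMmr [X in (_ %% X)%N]hE -muln_modr.
  by move: eq_xy; rewrite !mod_half; lia.
pose rest : rel 'Z_n := fun x y => (y - x \in S) && ~~ half_adj h S x y.
have restC : symmetric rest.
  by move=> x y; rewrite /rest half_adj_sym // -(opp_mem SN) opprB.
have rest0 : irreflexive rest by move=> x; rewrite /rest subrr (negPf S0).
have half_sub x : [set j | half_adj h S x j] \subset [set y | y - x \in S].
  by apply/subsetP=> j; rewrite !inE => /andP[].
(* By [L_le] at most [#|S| + 2 - L] edges remain at each vertex; one more color suffices for them,
   for a total of [#|S| + 3]. *)
have deg_rest x : (#|[set y | rest x y]| < #|S| + 3 - L)%N.
  have -> : [set y | rest x y] = [set y | y - x \in S] :\: [set j | half_adj h S x j].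
    by apply/setP=> y; rewrite !inE andbC.
  have := subset_leq_card (half_sub x); have := L_le x.
  rewrite cardsD (setIidPr (half_sub x)) card_translate; lia.
have [c [c0 cC cP] cE] := vizing restC rest0 deg_rest.
pose f (x : 'Z_n) := (2 * (x %% h) %% L)%N.
(* Retained edges use the colors below [L], the others those from [L] on; the default 0 is reached
   only by non-adjacent pairs. *)
pose g (x y : 'Z_n) := if half_adj h S x y then ((x %% h + y %% h) %% L)%N
  else if c x y is Some d then (L + d)%N else 0%N.
have L_gt0 : (0 < L)%N by lia.
have L_lt : (L < #|S| + 3)%N by have := deg_rest 0; lia.
have cdef (x y : 'Z_n) : y - x \in S -> half_adj h S x y = false ->
    exists d, c x y = Some d.
  move=> yxS xyH; case xy: (c x y) => [d|]; first by exists d.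
  by move/eqP: xy; rewrite cE /rest yxS xyH.
(* This separates two retained edges at [a], and also a retained edge from its endpoint [a], whose
   color is the sum of [a] with itself. *)
have key (a x y : 'Z_n) : ((a %% h + x %% h) %% L = (a %% h + y %% h) %% L)%N ->
    (x = y %[mod h])%N.
  have xh z : (z %% h < L)%N by apply: leq_trans hL; rewrite ltn_mod; lia.
  by move/eqP; rewrite eqn_modDl !(modn_small (xh _)) => /eqP.
apply: (@total_chromatic_number_leq (Cay hS) _ f g) => /=.
- by move=> x; apply: leq_trans (ltnW L_lt); rewrite ltn_mod.
- move=> x y; rewrite cayley_adjE /g => xy; case: ifP => xyH.
    by apply: leq_trans (ltnW L_lt); rewrite ltn_mod.
  by have [d ->] := cdef _ _ xy xyH; rewrite -ltn_subRL ltn_ord.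
- by move=> x y; rewrite /g half_adj_sym // addnC cC.
- by move=> x y; rewrite cayley_adjE => xy; apply/eqP/vertexP.
- move=> x y; rewrite cayley_adjE /f /g => xy; case: ifP => xyH.
    rewrite mul2n -addnn; apply/eqP => /key/esym.
    exact: (adj_modn_half nE h_gt1 S0 Sh xy).
  have [d ->] := cdef _ _ xy xyH; rewrite neq_ltn; apply/orP; left.
  by apply: leq_trans (leq_addr _ _); rewrite ltn_mod.
move=> x y z; rewrite !cayley_adjE /g => xy xz neq_yz.
case: ifP => xyH; case: ifP => xzH.
- apply: contraNneq neq_yz => /key eq_yz.
  by apply/eqP; apply: half_adj_inj xyH xzH eq_yz.
- have [d ->] := cdef _ _ xz xzH; rewrite neq_ltn; apply/orP; left.
  by apply: leq_trans (leq_addr _ _); rewrite ltn_mod.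
- have [d ->] := cdef _ _ xy xyH; rewrite neq_ltn; apply/orP; right.
  by apply: leq_trans (leq_addr _ _); rewrite ltn_mod.
have [d xyd] := cdef _ _ xy xyH; have [d' xzd] := cdef _ _ xz xzH.
rewrite xyd xzd eqn_add2l; apply: contraNneq neq_yz => /val_inj eq_d.
by rewrite (cP x y z d) // eq_d.
Qed.

End CirculantBound.

Theorem theorem3p3 (n : nat) (n_gt0 : (0 < n)%N) (n_even : ~~ odd n)
    (S : {set 'Z_n}) (hS : connection_set S)
    (no_involution : (n./2)%:R%R \notin S)
    (M : {set 'Z_n}) (sMS : M \subset S)
    (card_M : (#|M| + 2 = n./2)%N)
    (M_sum : forall mi mj : 'Z_n,
       mi \in M -> mj \in M -> (mi + mj)%R <> (n./2)%:R%R)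
    (gen_SM : <<S :\: M>>%g = [set: 'Z_n]) :
  (total_chromatic_number (Cay hS) <= max_degree (Cay hS) + 3)%N.
Proof.
have nE : n = 2 * n./2 by lia.
apply: leq_trans (circulant_total_chromatic hS nE no_involution sMS card_M M_sum) _.
(* The neighbourhood of the vertex 0 already has [#|S|] elements. *)
rewrite leq_add2r -(card_translate S 0%R) /max_degree.
apply: leq_trans (leq_bigmax (0%R : Cay hS)) => /=.
by apply/subset_leq_card/subsetP=> y; rewrite !inE cayley_adjE.
Qed.
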